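(* Let $G$ be a finite abelian group. Then: (i) if $\operatorname{diam}^+(G)\ge1$, then $t_1(G)=0$ and $s_1(G)=|G|$; (ii) if $\operatorname{diam}^+(G)\ge 2$, then $t_2(G)=s_2(G)=|G|-1$; (iii) if $\operatorname{diam}^+(G)\ge 3$, then $t_3(G)=s_3(G)=\lfloor |G|/2\rfloor$; (iv) if $\rho=\operatorname{diam}^+(G)\ge 2$, then $t_\rho(G)=s_\rho(G)=\operatorname{rk}(G)+1$.
   Context: Groups are written additively; $\operatorname{rk}(G)$ is the minimal number of generators of $G$. For $A\subseteq G$ let $A_0:=A\cup\{0\}$ and $\langle A\rangle^+_\rho:=\rho A_0=\{a_1+\dots+a_\rho:a_i\in A_0\}$. $\operatorname{diam}^+_A(G):=\min\{\rho\in\mathbb{N}_0:\langle A\rangle^+_\rho=G\}$ ($\min\varnothing=\infty$); $\operatorname{diam}^+(G):=\max\{\operatorname{diam}^+_A(G):\langle A\rangle=G\}$. The period of $S\subseteq G$ is $\pi(S):=\{g\in G:S+g=S\}$; $S$ is aperiodic if $\pi(S)=\{0\}$ and periodic otherwise. A subset $A\subseteq G$ is $\rho$-maximal if it is maximal under inclusion subject to $\operatorname{diam}^+_A(G)\ge\rho$, i.e. subject to $\langle A\rangle^+_{\rho-1}\neq G$. With the convention $\max\varnothing=0$: $s_\rho(G):=\max\{|A|: A\subseteq G,\ \rho\le\operatorname{diam}^+_A(G)<\infty\}$ and $t_\rho(G):=\max\{|A|: A \text{ is an aperiodic } \rho\text{-maximal generating set for } G\}$. *)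

(* Defs.v *)
From HB Require Import structures.
From mathcomp Require Import all_boot all_order all_algebra.
From Stdlib Require Import ClassicalEpsilon.
Set Implicit Arguments. Unset Strict Implicit. Unset Printing Implicit Defensive.
Import GRing.Theory.
Local Open Scope ring_scope.

Section Defs.
Variable V : finZmodType.

Definition is_subgroup (H : {set V}) : bool :=
  (0 \in H) && [forall a, forall b, (a \in H) ==> (b \in H) ==> (a - b \in H)].

Definition gen (A : {set V}) : {set V} :=
  [set x | [forall H : {set V}, (is_subgroup H && (A \subset H)) ==> (x \in H)]].

Definition generates (A : {set V}) : bool := gen A == [set: V].

Definition rk : nat :=
  \big[minn/#|[set: V]|]_(A : {set V} | generates A) #|A|.

Definition sumset (A : {set V}) (rho : nat) : {set V} :=
  iter rho (fun S : {set V} => [set x + y | x in S, y in (0 |: A)]) [set 0].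

(* diam^+_A(G) in nat extended by None = infinity *)
Definition diamA (A : {set V}) : option nat :=
  match excluded_middle_informative (exists r, sumset A r == [set: V]) with
  | left H => Some (ex_minn H)
  | right _ => None
  end.

Definition omax (d e : option nat) : option nat :=
  match d, e with Some a, Some b => Some (maxn a b) | _, _ => None end.

Definition diamP : option nat :=
  \big[omax/Some 0%N]_(A : {set V} | generates A) diamA A.

Definition oge (d : option nat) (n : nat) : bool :=
  if d is Some k then (n <= k)%N else true.

Definition fin_ge (d : option nat) (n : nat) : bool :=
  if d is Some k then (n <= k)%N else false.

Definition period (S : {set V}) : {set V} :=
  [set g | [set s + g | s in S] == S].

Definition aperiodic (S : {set V}) : bool := period S == [set 0].

Definition rho_maximal (rho : nat) (A : {set V}) : bool :=
  maxset (fun B : {set V} => sumset B rho.-1 != [set: V]) A.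

Definition s_ (rho : nat) : nat :=
  \max_(A : {set V} | fin_ge (diamA A) rho) #|A|.

Definition t_ (rho : nat) : nat :=
  \max_(A : {set V} | [&& aperiodic A, rho_maximal rho A & generates A]) #|A|.

End Defs.

(* Main.v *)
Require Import Defs.
From mathcomp Require Import all_boot all_order all_algebra.
From mathcomp Require Import all_fingroup all_solvable zify.
From Stdlib Require Import ClassicalEpsilon.
Set Implicit Arguments. Unset Strict Implicit. Unset Printing Implicit Defensive.
Import Order.TTheory GRing.Theory Num.Theory FinRing.Theory.
Local Open Scope ring_scope.

(** For rho = 2 and rho = 3 the upper bounds come from [0 |: A <> G] and from the disjointness of
    [A] and [g - A] when [g] is missed by [2 (0 |: A)]; a set attaining the bound is automatically
    maximal, so only aperiodic generating examples are needed.

    For rho = diam^+(G), let [m_1, m_2, ...] be the invariant factors in decreasing order. Given a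
    generating set [A], choose [a_1, a_2, ...] in [A] greedily, each of maximal order [n_j] modulo the
    subgroup [H_(j-1)] generated by its predecessors. Then [n_1 >= n_2 >= ...], and
    [n_1 ... n_j = |H_j| <= m_1 ... m_j] because [H_j] has rank at most [j]. Summation by parts and
    AM-GM give [sum (n_j - 1) <= sum (m_j - 1)], with equality only if [n_j = m_j] for all [j]; every
    element has a representation of length at most [sum (n_j - 1)]. If [A] has more than [rk G]
    nonzero elements, either the inequality is strict or some element of [A] outside the chain
    shortens the single longest representation, so [diam^+_A(G) < sum (m_j - 1)]. A basis attains
    [sum (m_j - 1)], hence sets of maximal diameter have at most [rk G] nonzero elements. *)

(** * Sumsets, diameters and periods *)

Section Generation.
Variable V : finZmodType.
Implicit Types (A B S : {set V}) (x y : V).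

Lemma is_subgroupP (H : {set V}) :
  reflect (0 \in H /\ {in H &, forall x y, x - y \in H}) (is_subgroup H).
Proof.
apply: (iffP andP) => [[H0 /forallP HB]|[H0 HB]]; split=> //.
  by move=> x y Hx Hy; move/forallP/(_ y): (HB x); rewrite Hx Hy.
by apply/forallP=> x; apply/forallP=> y; apply/implyP=> Hx; apply/implyP; apply: HB.
Qed.

(** A [finZmodType] is also a [finGroupType]; this link opens the way to Lagrange, quotients and the
    structure theorem for abelian groups. *)
Lemma is_subgroup_group_set (H : {set V}) : is_subgroup H = group_set H.
Proof.
apply/is_subgroupP/group_setP => [[H0 HB]|[H1 HM]]; split=> //.
  move=> x y Hx Hy; rewrite zmodMgE -[y]opprK; apply: (HB) => //.
  by rewrite -sub0r; apply: HB.
pose G := group (introT group_setP (conj H1 HM)).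
by move=> x y Hx Hy; apply: (groupM (G := G)) => //; apply: (groupVr (G := G)).
Qed.

Lemma group_zero (H : {group V}) : 0 \in H. Proof. exact (group1 H). Qed.

Lemma group_addr (H : {group V}) x y : x \in H -> (y + x \in H) = (y \in H).
Proof. exact: (groupMr (G := H)). Qed.

Lemma group_add (H : {group V}) x y : x \in H -> y \in H -> x + y \in H.
Proof. exact: (groupM (G := H)). Qed.

Lemma group_opp (H : {group V}) x : (- x \in H) = (x \in H).
Proof. exact: (groupV H). Qed.

Lemma group_mulrn (H : {group V}) x c : x \in H -> x *+ c \in H.
Proof. by rewrite -zmodXgE; apply: groupX. Qed.

Lemma genE A : gen A = <<A>>%g.
Proof.
apply/setP=> x; rewrite inE; apply/forallP/idP => [Hx|Ax H].
  have := Hx <<A>>%g; rewrite is_subgroup_group_set groupP subset_gen; exact.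
apply/implyP=> /andP[]; rewrite is_subgroup_group_set => gH sAH.
by move: Ax; apply: subsetP; rewrite (gen_subG A (group gH)).
Qed.

Lemma generatesE A : generates A = (<<A>>%g == [set: V]).
Proof. by rewrite /generates genE. Qed.

Lemma generatesS A B : A \subset B -> generates A -> generates B.
Proof.
move=> sAB; rewrite !generatesE => /eqP gA.
by rewrite eqEsubset subsetT -gA genS.
Qed.

Lemma generates_setT : generates [set: V].
Proof. by rewrite generatesE eqEsubset subsetT subset_gen. Qed.

Lemma generates_sub_group A (H : {group V}) :
  generates A -> A \subset H -> H = [set: V] :> {set V}.
Proof.
rewrite generatesE => /eqP gA sAH; apply/eqP; rewrite eqEsubset subsetT -gA.
by rewrite gen_subG.
Qed.

Lemma generatesP A :
  (forall H : {group V}, A \subset H -> H = [set: V] :> {set V}) -> generates A.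
Proof. by move=> gA; rewrite generatesE (gA <<A>>%G) // subset_gen. Qed.

Lemma sumset0 A : sumset A 0 = [set 0]. Proof. by []. Qed.

Lemma sumsetSP A t x :
  reflect (exists y a, [/\ y \in sumset A t, a \in 0 |: A & x = y + a])
          (x \in sumset A t.+1).
Proof.
rewrite /sumset iterS -/(sumset A t); apply: (iffP imset2P).
  by case=> y a Hy Ha ->; exists y, a.
by case=> y [a] [Hy Ha ->]; exists y a.
Qed.

Lemma sumset_0 A t : 0 \in sumset A t.
Proof.
elim: t => [|t IH]; first by rewrite sumset0 set11.
by apply/sumsetSP; exists 0, 0; rewrite IH setU11 addr0.
Qed.

Lemma sumset1 A : sumset A 1 = 0 |: A.
Proof.
apply/setP=> x; apply/sumsetSP/idP=> [[y] [a] []|Ax].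
  by rewrite sumset0 => /set1P-> Aa ->; rewrite add0r.
by exists 0, x; rewrite sumset0 set11 add0r.
Qed.

Lemma sumsetD A s t x y :
  x \in sumset A s -> y \in sumset A t -> x + y \in sumset A (s + t).
Proof.
move=> Ax; elim: t y => [|t IH] y; first by rewrite sumset0 => /set1P->; rewrite addr0 addn0.
case/sumsetSP=> z [a] [Az Aa ->]; rewrite addnS; apply/sumsetSP.
by exists (x + z), a; rewrite addrA IH.
Qed.

Lemma sumset_leq A s t : (s <= t)%N -> sumset A s \subset sumset A t.
Proof.
move=> /subnK <-; apply/subsetP=> x Ax.
by rewrite addnC -[x]addr0 sumsetD ?sumset_0.
Qed.

Lemma sumset_mulrn A a c : a \in 0 |: A -> a *+ c \in sumset A c.
Proof.
move=> Aa; elim: c => [|c IH]; first by rewrite mulr0n sumset0 set11.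
by rewrite mulrSr -addn1 sumsetD // sumset1.
Qed.

Lemma sumset_sum A (I : Type) (r : seq I) (a : I -> V) (c : I -> nat) :
  (forall i, a i \in 0 |: A) -> \sum_(i <- r) a i *+ c i \in sumset A (\sum_(i <- r) c i)%N.
Proof.
move=> Aa; elim: r => [|i r IH]; first by rewrite !big_nil sumset0 set11.
by rewrite !big_cons sumsetD // sumset_mulrn.
Qed.

Lemma sumset_full_leq A s t :
  (s <= t)%N -> sumset A s = [set: V] -> sumset A t = [set: V].
Proof. by move=> st As; apply/eqP; rewrite eqEsubset subsetT -As sumset_leq. Qed.

(* If [sumset A t] stops growing, it is closed under adding elements of [A], hence a subgroup. *)
Lemma card_sumsetS A t : generates A -> sumset A t != [set: V] ->
  (#|sumset A t| < #|sumset A t.+1|)%N.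
Proof.
move=> gA AtN; apply: proper_card; rewrite properEneq sumset_leq // andbT.
apply: contra AtN => /eqP At.
have cl k : sumset A (k + t) = sumset A t.
  elim: k => // k IH; rewrite addSn At; apply/setP=> x.
  by apply/sumsetSP/sumsetSP=> -[y] [a]; rewrite IH => -H; exists y, a.
have clD : {in sumset A t &, forall x y, x + y \in sumset A t}.
  by move=> x y Hx Hy; rewrite -(cl t) sumsetD.
have gS : group_set (sumset A t) by apply/group_setP; split; rewrite ?sumset_0.
apply/eqP; apply: (generates_sub_group (H := group gS) gA) => /=.
rewrite -(cl 1%N) addSn add0n; apply/subsetP=> a Aa; apply/sumsetSP.
by exists 0, a; rewrite sumset_0 add0r inE Aa orbT.
Qed.

Lemma card_sumset_gt A t : generates A -> sumset A t != [set: V] ->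
  (t < #|sumset A t|)%N.
Proof.
move=> gA; elim: t => [|t IH] AtN; first by rewrite sumset0 cards1.
have AtN' : sumset A t != [set: V].
  by apply: contra AtN => /eqP/(sumset_full_leq (leqnSn t))->.
exact: leq_ltn_trans (IH AtN') (card_sumsetS gA AtN').
Qed.

Lemma sumset_generates A : generates A -> sumset A #|V| = [set: V].
Proof.
move=> gA; apply/eqP; case: eqP => // /eqP /(card_sumset_gt gA).
by rewrite ltnNge max_card.
Qed.

Lemma sumset_sub_group A (H : {group V}) t : A \subset H -> sumset A t \subset H.
Proof.
move=> sAH; elim: t => [|t IH]; first by rewrite sumset0 sub1set; apply: group_zero.
apply/subsetP=> x /sumsetSP[y] [a] [Ay Aa ->]; apply: group_add; first exact: (subsetP IH).
by case/setU1P: Aa => [->|Aa]; [exact: group_zero|exact: (subsetP sAH)].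
Qed.

Lemma generates_sumset A t : sumset A t = [set: V] -> generates A.
Proof.
move=> At; apply: generatesP => H sAH; apply/eqP.
by rewrite eqEsubset subsetT -At sumset_sub_group.
Qed.

(** * Diameters expressed through sumsets *)

Lemma diamA_Some A d : diamA A = Some d ->
  sumset A d = [set: V] /\ (forall r, (r < d)%N -> sumset A r != [set: V]).
Proof.
rewrite /diamA; case: excluded_middle_informative => // H [<-].
case: ex_minnP => m /eqP Am min_m; split=> // r rm.
by apply: contraL rm => /min_m; rewrite leqNgt.
Qed.

Lemma diamA_generates A : generates A -> exists d, diamA A = Some d.
Proof.
move=> gA; rewrite /diamA; case: excluded_middle_informative => [H|]; first by exists (ex_minn H).
by case; exists #|V|; rewrite sumset_generates.
Qed.

(** Finite diameter amounts to generation, so the classical case distinction in [diamA] gives way to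
    a condition on one sumset. *)
Lemma fin_ge_diamA A r : (0 < r)%N ->
  fin_ge (diamA A) r = generates A && (sumset A r.-1 != [set: V]).
Proof.
move=> r_gt0; have [gA|ngA] := boolP (generates A); last first.
  case Dd: (diamA A) => [d|//]; have [Ad _] := diamA_Some Dd.
  by case/negP: ngA; apply: generates_sumset Ad.
have [d Dd] := diamA_generates gA; have [Ad min_d] := diamA_Some Dd.
rewrite Dd /=; apply/idP/idP => [rd|]; first by apply: min_d; lia.
apply: contraR; rewrite -ltnNge => dr; apply/eqP; apply: sumset_full_leq Ad; lia.
Qed.

Lemma fin_ge_oge A r : generates A -> oge (diamA A) r = fin_ge (diamA A) r.
Proof. by case/diamA_generates=> d ->. Qed.

Lemma oge_diamP r : (0 < r)%N -> oge (diamP V) r ->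
  exists2 A, generates A & sumset A r.-1 != [set: V].
Proof.
move=> r_gt0 dV.
suff /existsP[A /andP[gA]]: [exists A : {set V}, generates A && oge (diamA A) r].
  by rewrite fin_ge_oge // fin_ge_diamA // gA => AN; exists A.
apply: contraLR dV => /existsPn all_lt.
rewrite /diamP; elim/big_ind: _ => [|d e|A gA]; first by rewrite /= -ltnNge.
  by case: d e => [d|//] [e|//] /=; lia.
by have := all_lt A; rewrite gA.
Qed.

(** [None] absorbs under [omax], so a finite maximum makes every term finite; the induction runs
    over the enumeration defining the maximum. *)
Lemma diamP_max A d : diamP V = Some d -> generates A -> sumset A d = [set: V].
Proof.
rewrite /diamP => Dd gA.
suff [e]: exists2 e, diamA A = Some e & (e <= d)%N.
  by case/diamA_Some => Ae _ ed; apply: sumset_full_leq Ae.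
have : A \in index_enum {set V} by rewrite mem_index_enum.
elim: (index_enum _) d Dd => // B r IH d; rewrite big_cons inE.
case: ifP => [gB|gBN]; last first.
  move=> /IH {}IH /predU1P[AB|/IH//].
  by rewrite -AB gA in gBN.
case Db: (diamA B) => [b|//].
case Dr: (\big[_/_]_(_ <- r | _) _) => [e|//] [<-] /predU1P[->|].
  by exists b => //; apply: leq_maxl.
by case/(IH _ Dr)=> f -> fe; exists f => //; rewrite leq_max fe orbT.
Qed.

(** * Periods and the extremal criterion *)

Lemma in_period S k : (k \in period S) = ([set s + k | s in S] == S).
Proof. by rewrite inE. Qed.

Lemma period0 S : 0 \in period S.
Proof.
rewrite in_period; apply/eqP; rewrite -[RHS]imset_id; apply: eq_imset => x.
exact: addr0.
Qed.

Lemma periodP S k : reflect (forall x, (x + k \in S) = (x \in S)) (k \in period S).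
Proof.
rewrite in_period; apply: (iffP eqP) => [Sk x|Sk].
  rewrite -{1}Sk; apply/imsetP/idP => [[s Ss /addIr->//]|Sx]; by exists x.
apply/setP=> x; rewrite -[in RHS](subrK k x) Sk.
apply/imsetP/idP => [[s Ss ->]|Sx]; first by rewrite addrK.
by exists (x - k); rewrite ?subrK.
Qed.

Lemma aperiodicP S : (forall k, k \in period S -> k = 0) -> aperiodic S.
Proof.
move=> S0; apply/eqP/setP=> k; rewrite in_set1; apply/idP/eqP => [/S0//|->]; exact: period0.
Qed.

Lemma group_period (H : {group V}) k : k \in H -> k \in period H.
Proof. by move=> Hk; apply/periodP=> x; rewrite group_addr. Qed.

(** Any superset with the same sumset condition still generates, so the bound [M] forces it to be
    [A]. Thus one aperiodic example of size [M] settles both invariants. *)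
Lemma extremal_card r M A : (0 < r)%N ->
    (forall B, generates B -> sumset B r.-1 != [set: V] -> (#|B| <= M)%N) ->
    generates A -> sumset A r.-1 != [set: V] -> aperiodic A -> #|A| = M ->
  t_ V r = M /\ s_ V r = M.
Proof.
move=> r_gt0 maxM gA Ar apA cardA; split; apply/eqP; rewrite eqn_leq /t_ /s_; apply/andP; split.
- by apply/bigmax_leqP=> B /and3P[_ /maxsetP[Br _] gB]; apply: maxM.
- rewrite -{1}cardA; apply: (leq_bigmax_cond A); rewrite apA gA andbT /=.
  apply/maxsetP; split=> // B Br sAB; apply/esym/eqP; rewrite eqEcard sAB cardA.
  by apply: maxM => //; apply: generatesS gA.
- apply/bigmax_leqP=> B; rewrite fin_ge_diamA // => /andP[gB Br]; exact: maxM.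
by rewrite -{1}cardA; apply: (leq_bigmax_cond A); rewrite fin_ge_diamA // gA.
Qed.

End Generation.

(** * Diameters 1, 2 and 3 *)

Section SmallDiameter.
Variable V : finZmodType.
Implicit Types (A B S : {set V}) (x y : V).

Lemma exists_neq0 : (1 < #|V|)%N -> exists g : V, g != 0.
Proof.
move=> V_gt1; apply/existsP; apply: contraLR V_gt1; rewrite negb_exists => /forallP V0.
rewrite -leqNgt -cardsT -(cards1 (0 : V)) subset_leq_card //.
by apply/subsetP=> x _; rewrite in_set1; apply/negbNE/V0.
Qed.

Lemma card_proper_group (H : {group V}) :
  H != [set: V] :> {set V} -> (#|H| * 2 <= #|V|)%N.
Proof.
move=> HN; rewrite -cardsT -(Lagrange (subsetT H)) leq_mul2l; apply/orP; right.
by rewrite indexg_gt1; apply: contra HN => HT; rewrite eqEsubset subsetT.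
Qed.

(* A set of at least [|V| / 2] elements in a proper subgroup must be that subgroup, hence periodic. *)
Lemma half_aperiodic_generates A :
  (#|V| %/ 2 <= #|A|)%N -> (1 < #|A|)%N -> aperiodic A -> generates A.
Proof.
move=> half A_gt1 /eqP apA; apply: generatesP => H sAH; apply/eqP.
case: eqP => // /eqP /card_proper_group HN.
have AH : A = H by apply/eqP; rewrite eqEcard sAH /= (leq_trans _ half) // leq_divRL.
suff : H \subset [set (0 : V)] by move/subset_leq_card; rewrite cards1 -AH leqNgt A_gt1.
by rewrite -apA AH; apply/subsetP=> k; apply: group_period.
Qed.

(** Since [sumset A 0 = [set 0]] for every [A], the whole group is the only maximal set, and each of
    its elements is a period. *)
Lemma t1_s1 : (1 < #|V|)%N -> t_ V 1 = 0%N /\ s_ V 1 = #|[set: V]|.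
Proof.
move=> V_gt1; have setT_N1 : sumset [set: V] 0 != [set: V].
  by rewrite sumset0 eqEcard subsetT cards1 cardsT -ltnNge.
split.
  rewrite /t_ big_pred0 // => A; apply/and3P => -[/eqP apA /maxsetP[_ maxA] _].
  have AT : A = setT by rewrite (maxA setT) ?subsetT.
  have : [set: V] \subset [set (0 : V)].
    by rewrite -apA AT; apply/subsetP=> k _; apply/periodP=> x; rewrite !inE.
  by move/subset_leq_card; rewrite cards1 cardsT leqNgt V_gt1.
apply/eqP; rewrite eqn_leq /s_; apply/andP; split.
  by apply/bigmax_leqP => A _; rewrite subset_leq_card ?subsetT.
apply: (leq_bigmax_cond [set: V]); rewrite fin_ge_diamA // generates_setT.
exact: setT_N1.
Qed.

(** A period also preserves the complement, hence fixes [p]. *)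
Lemma compl1_aperiodic p S : ~: S = [set p] -> aperiodic S.
Proof.
move=> Sp; have Sx x : (x \in S) = (x != p).
  by rewrite -[x \in S]negbK -in_setC Sp in_set1.
apply: aperiodicP => k /periodP/(_ p); rewrite !Sx eqxx => /negbFE/eqP.
by rewrite -[RHS]addr0 => /addrI.
Qed.

(** As [sumset B 1] is [0 |: B], the complement of a nonzero element is extremal. *)
Lemma t2_s2 : (2 < #|V|)%N ->
  t_ V 2 = #|[set: V]|.-1 /\ s_ V 2 = #|[set: V]|.-1.
Proof.
move=> V_gt2; have [g g0] := exists_neq0 (ltnW V_gt2).
have cardA : #|~: [set g]| = #|[set: V]|.-1 by rewrite cardsCs setCK cards1 cardsT subn1.
have apA : aperiodic (~: [set g]) by apply: compl1_aperiodic; rewrite setCK.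
apply: (@extremal_card V 2 _ (~: [set g])) => //.
- move=> B _; rewrite sumset1 => BN.
  have : (#|B| < #|[set: V]|)%N.
    apply: proper_card; rewrite properE subsetT /=; apply: contra BN => TB.
    by rewrite eqEsubset subsetT (subset_trans TB) ?subsetUr.
  by case: #|[set: V]|.
- by apply: half_aperiodic_generates => //; rewrite cardA cardsT; move: #|V| V_gt2 => n; lia.
rewrite sumset1; apply/eqP=> /setP/(_ g).
by rewrite !inE eqxx orbF (negPf g0).
Qed.

(** * Diameter 3: the upper bound and sets attaining it *)

Lemma sumset2_missing g A : (g \notin sumset A 2) <->
  (forall x, x \in 0 |: A -> g - x \notin 0 |: A).
Proof.
rewrite -sumset1; split=> [gN x Ax|gN].
  by apply: contra gN => Agx; rewrite -[g](subrK x) (sumsetD (s := 1) (t := 1)).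
apply/negP=> /sumsetSP[y] [a] [Ay Aa gya].
by have := gN y Ay; rewrite gya addrC addKr sumset1 Aa.
Qed.

(* If [g] is missed by [sumset B 2], then [B] and [g - B] are disjoint. *)
Lemma card_sumset2 B : sumset B 2 != [set: V] -> (#|B| <= #|V| %/ 2)%N.
Proof.
rewrite -subTset => /subsetPn[g _ /sumset2_missing gN].
have dis : [disjoint B & [set g - x | x in B]].
  apply/pred0P=> y /=; apply/andP=> -[By /imsetP[x Bx yx]].
  by have := gN x; rewrite -yx !inE Bx By !orbT => /(_ isT).
have inj : injective (fun x : V => g - x) by move=> x y /addrI/oppr_inj.
have := subset_leq_card (subsetT (B :|: [set g - x | x in B])).
by rewrite cardsU (disjoint_setI0 dis) cards0 card_imset // cardsT; move: #|V| #|B| => n b; lia.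
Qed.

Lemma t3_s3_from A : (3 < #|V|)%N -> aperiodic A -> sumset A 2 != [set: V] ->
    (#|V| %/ 2 <= #|A|)%N ->
  t_ V 3 = (#|[set: V]| %/ 2)%N /\ s_ V 3 = (#|[set: V]| %/ 2)%N.
Proof.
move=> V_gt3 apA AN half; rewrite cardsT.
apply: (@extremal_card V 3 _ A) => //; first by move=> B _; apply: card_sumset2.
  by apply: half_aperiodic_generates => //; lia.
by have := card_sumset2 AN; lia.
Qed.

Lemma mulrn_coprime_eq0 x m : x *+ m = 0 -> coprime m #|V| -> x = 0.
Proof.
move=> xm0 cop; have xm : (#[x]%g %| m)%N by rewrite order_dvdn zmodXgE xm0.
have xV : (#[x]%g %| #|V|)%N by rewrite -cardsT order_dvdG ?in_setT.
have : (#[x]%g %| 1)%N by rewrite -(eqP cop) dvdn_gcd xm xV.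
by rewrite dvdn1 order_eq1 => /eqP.
Qed.

(** In odd order the reflection [x |-> g - x] has at most one fixed point. [A] takes one point from
    each two-point orbit, so [A] and [g - A] cover all but one point; a period of [A] is a period of
    this union, hence 0. *)
Lemma odd_half_witness : odd #|V| -> (1 < #|V|)%N ->
  exists A, [/\ aperiodic A, sumset A 2 != [set: V] & (#|V| %/ 2 <= #|A|)%N].
Proof.
move=> oddV V_gt1; have [g g0] := exists_neq0 V_gt1.
pose P B := (0 \in B) && [forall x in B, g - x \notin B].
have [A /maxsetP[/andP[A0 /forall_inP AP] maxA] _] : {A | maxset P A & [set 0] \subset A}.
  apply: maxset_exists; rewrite /P set11; apply/forall_inP=> x /set1P->.
  by rewrite subr0 in_set1.
have A0E : 0 |: A = A by apply/setUidPr; rewrite sub1set.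
have AN : sumset A 2 != [set: V].
  rewrite -subTset; apply/subsetPn; exists g; rewrite ?in_setT //.
  by apply/sumset2_missing; rewrite A0E.
(* An uncovered point that is not fixed could be added to [A], contrary to maximality. *)
have cover x : x \notin A -> g - x \notin A -> g - x = x.
  move=> Ax Agx; apply/eqP; apply: contraNT Ax => gxx.
  rewrite -(maxA (x |: A)) ?setU11 ?subsetUr // /P !inE A0 orbT /=.
  apply/forall_inP=> y; rewrite !inE negb_or => /predU1P[->|Ay]; first by rewrite gxx Agx.
  rewrite AP // andbT; apply: contra Agx => /eqP <-.
  by rewrite opprB addrC subrK.
have uniq2 x y : g - x = x -> g - y = y -> x = y.
  move=> xg yg; apply/eqP; rewrite -subr_eq0; apply/eqP.
  apply: (@mulrn_coprime_eq0 _ 2); last by rewrite coprime2n.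
  have dbl z : g - z = z -> z *+ 2 = g by rewrite mulr2n => {1}<-; rewrite subrK.
  by rewrite mulrnBl !dbl // subrr.
have inj : injective (fun x : V => g - x) by move=> x y /addrI/oppr_inj.
pose gA := [set g - x | x in A].
have in_gA x : (x \in gA) = (g - x \in A).
  apply/imsetP/idP => [[y Ay ->]|Agx]; first by rewrite opprB addrC subrK.
  by exists (g - x) => //; rewrite opprB addrC subrK.
have dis : A :&: gA = set0.
  apply/setP=> x; rewrite !inE in_gA; apply/andP=> -[Ax].
  by apply/negP; apply: AP.
have cU : #|A :|: gA| = (#|A| * 2)%N.
  by rewrite cardsU dis cards0 card_imset // subn0 addnn muln2.
have cC : (#|~: (A :|: gA)| <= 1)%N.
  apply/card_le1_eqP => x y; rewrite !inE !in_gA !negb_or => /andP[Ax gx] /andP[Ay gy].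
  by apply: uniq2; apply: cover.
have cV : (#|A| * 2 + #|~: (A :|: gA)| = #|V|)%N by rewrite -cU cardsC.
exists A; split=> //; last by move: cC cV; move: #|V| #|A| #|~: _| => n a c; lia.
have /cards1P[p Cp] : #|~: (A :|: gA)| == 1%N.
  move: cC cV oddV; move: #|V| #|A| #|~: _| => n a c; lia.
have := compl1_aperiodic Cp => /eqP apU; apply: aperiodicP => k /periodP kA.
suff : k \in [set (0 : V)] by move/set1P.
rewrite -apU; apply/periodP=> x; rewrite !inE !in_gA kA; congr (_ || _).
by rewrite -kA opprD addrA subrK.
Qed.

(* A subgroup containing [2V], maximal among those avoiding some [g] outside [2V], has index 2. *)
Lemma index2_subgroup : ~~ odd #|V| -> exists2 H : {group V}, (#|H| * 2 = #|V|)%N &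
  forall x y, x \notin H -> y \notin H -> x + y \in H.
Proof.
move=> evenV; pose D := [set x + x | x : V].
have gD : group_set D.
  apply/group_setP; split; first by apply/imsetP; exists 0; rewrite // addr0.
  move=> _ _ /imsetP[x _ ->] /imsetP[y _ ->]; apply/imsetP; exists (x + y) => //.
  by rewrite zmodMgE addrACA.
(* An element of order 2 makes doubling non-injective, hence not surjective. *)
have [g gND] : exists g, g \notin D.
  apply/existsP; apply: contraLR evenV; rewrite negb_exists negbK => /forallP DT.
  have /imset_injP inj : #|D| == #|V|.
    by rewrite -cardsT; apply/eqP/eq_card => x; rewrite [RHS]inE; apply/negbNE/DT.
  rewrite -[odd _]negbK -dvdn2 -cardsT; apply/negP => /(@Cauchy _ 2 [set: V]%G isT)[z _ oz].
  have z0 : z = 0.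
    apply: (inj z 0); rewrite ?inE // addr0 -mulr2n -zmodXgE -oz.
    exact: expg_order.
  by move: oz; rewrite z0 -zmod1gE order1.
have [H /maxgroupP[/andP[gH /subsetP DH] maxH] _] :
    {H : {group V} | [max H | (g \notin H) && (D \subset H)]%g & group gD \subset H}.
  by apply: maxgroup_exists; rewrite gND subxx.
have HC x : x \notin H -> g - x \in H.
  (* As [x + x] lies in [H], the union of [H] and [x + H] is a strictly larger subgroup, so
     maximality puts [g] into it. *)
  move=> Hx; pose K := H :|: [set y | y - x \in H].
  have Hxx : x + x \in H by apply: DH; apply: imset_f.
  have gK : group_set K.
    apply/group_setP; split; first by rewrite inE (group_zero H).
    move=> y z; rewrite !inE zmodMgE => /orP[Hy|Hy] /orP[Hz|Hz].
    - by rewrite (group_add Hy Hz).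
    - by rewrite -addrA (group_add Hy Hz) orbT.
    - by rewrite addrAC (group_add Hy Hz) orbT.
    have -> : y + z = y - x + (z - x) + (x + x) by rewrite [RHS]addrACA !subrK.
    by rewrite (group_add (group_add Hy Hz) Hxx).
  have gKin : g \in K.
    apply: contraNT Hx => gKN; rewrite -(maxH (group gK)) /=; last exact: subsetUl.
      by rewrite !inE subrr (group_zero H) orbT.
    by rewrite gKN /=; apply/subsetP=> y /DH; rewrite inE => ->.
  by move: gKin; rewrite !inE (negPf gH).
exists H; last first.
  move=> x y /HC Hx /HC Hy; rewrite -group_opp -(group_addr (x := g + g));
    last by apply: DH; apply: imset_f.
  by rewrite opprD addrC addrACA group_add.
apply/eqP; rewrite eqn_leq card_proper_group /=; last first.
  by apply: contra gH => /eqP->; rewrite inE.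
have sub : [set: V] \subset H :|: [set g - x | x in H].
  apply/subsetP=> x _; rewrite inE; have [//|/HC Hgx] := boolP (x \in H).
  by apply/imsetP; exists (g - x) => //; rewrite opprB addrC subrK.
have := leq_trans (subset_leq_card sub) (leq_card_setU _ _).
rewrite cardsT muln2 -addnn => h; apply: leq_trans h _; rewrite leq_add2l.
exact: leq_imset_card.
Qed.

(** Exchange a nonzero [u] of [H] for [v]. Two summands with sum [u + v] would include exactly one
    outside [H], namely [v], leaving the removed [u]. A nonzero period lies in [A] but not in [H],
    hence is [v]; then [H] is [{0, u}] and [v + v = 0], which the last hypothesis excludes. *)
Lemma even_half_witness (H : {group V}) v : (#|H| * 2 = #|V|)%N ->
    (forall x y, x \notin H -> y \notin H -> x + y \in H) -> v \notin H ->
    (1 < #|H|)%N -> v + v != 0 \/ (2 < #|H|)%N ->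
  exists A, [/\ aperiodic A, sumset A 2 != [set: V] & (#|V| %/ 2 <= #|A|)%N].
Proof.
move=> cardH HNN Hv H_gt1 v2.
have HC x : (v + x \in H) = (x \notin H).
  by have [Hx|Hx] := boolP (x \in H); [rewrite group_addr // (negPf Hv) | rewrite HNN].
have [u Hu u0] : exists2 u, u \in H & u != 0.
  apply/exists_inP; apply: contraLR H_gt1; rewrite negb_exists => /forallP H0.
  rewrite -leqNgt -(cards1 (0 : V)) subset_leq_card //.
  by apply/subsetP=> x Hx; rewrite in_set1; have := H0 x; rewrite Hx negbK.
have uv : (u == v) = false by apply: contraNF Hv => /eqP <-.
pose A := v |: (H :\ u).
have A0 : 0 |: A = A.
  by apply/setUidPr; rewrite sub1set !inE [0 == u]eq_sym u0 (group_zero H) orbT.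
have AN : u + v \notin sumset A 2.
  apply/sumset2_missing => x; rewrite A0 !inE => /predU1P[->|/andP[xu Hx]].
    by rewrite addrK uv eqxx.
  rewrite !negb_or negb_and negbK; apply/andP; split.
    by apply: contra xu => /eqP; rewrite -[RHS]add0r addrAC => /addIr/eqP; rewrite subr_eq0 eq_sym.
  by rewrite addrAC addrC HC negbK (group_add Hu) ?group_opp ?orbT.
exists A; split; last 1 first.
- by rewrite -cardH mulnK // (cardsD1 u H) Hu cardsU1 !inE (negPf Hv) andbF.
- apply: aperiodicP => k /periodP kA; apply/eqP; apply: contraT => k0.
  have Ak : k \in A by rewrite -[k]add0r kA -A0 setU11.
  have [Hk|Hk] := boolP (k \in H).
    have uk : u - k != u by rewrite -subr_eq0 addrAC subrr sub0r oppr_eq0.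
    by have := kA (u - k); rewrite subrK !inE eqxx uv /= group_addr ?group_opp // Hu uk orbT.
  have kv : k = v by move: Ak; rewrite !inE (negPf Hk) andbF orbF => /eqP.
  have H0u x : x \in H -> x != u -> x = 0.
    move=> Hx xu; have := kA x; rewrite kv !inE Hx xu orbT addrC HC Hx andbF orbF.
    by rewrite -[eqbRHS]addr0 => /eqP/addrI.
  have vv0 : v + v = 0.
    have := kA v; rewrite kv !inE eqxx HC Hv andbT => /predU1P[vv|].
      by have := HC v; rewrite vv (negPf Hv).
    by move=> vu; apply: H0u; rewrite // HC.
  case: v2; rewrite ?vv0 ?eqxx // => H_gt2.
  have : H \subset [set 0; u].
    apply/subsetP=> x Hx; rewrite !inE; case: eqVneq => //= x0.
    by apply: contraNT x0 => xu; rewrite (H0u x).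
  by move/subset_leq_card; rewrite cards2 leqNgt eq_sym u0 H_gt2.
by apply: contra AN => /eqP->; rewrite inE.
Qed.

Lemma t3_s3 A : generates A -> sumset A 2 != [set: V] ->
  t_ V 3 = (#|[set: V]| %/ 2)%N /\ s_ V 3 = (#|[set: V]| %/ 2)%N.
Proof.
move=> gA AN; have S2 := card_sumset_gt gA AN; have lt23 := card_sumsetS gA AN.
have V_gt3 : (3 < #|V|)%N by apply: leq_trans (leq_ltn_trans S2 lt23) (max_card _).
suff [B [apB BN half]] : exists B, [/\ aperiodic B, sumset B 2 != [set: V] & (#|V| %/ 2 <= #|B|)%N].
  exact: (t3_s3_from V_gt3 apB BN half).
have [oddV|/index2_subgroup[H cardH HNN]] := boolP (odd #|V|).
  by apply: odd_half_witness => //; apply: ltn_trans V_gt3.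
have H_gt1 : (1 < #|H|)%N by move: V_gt3; rewrite -cardH; move: #|H| => h; lia.
have [v Av Hv] : exists2 v, v \in A & v \notin H.
  apply/subsetPn; apply/negP => /(generates_sub_group gA) HT.
  by move: V_gt3 cardH; rewrite HT cardsT; move: #|V| => n; lia.
apply: (even_half_witness cardH HNN Hv H_gt1).
have [H_gt2|H_le2] := ltnP 2 #|H|; [by right | left].
(* In order 4, strict growth leaves room only for [sumset A 1 = [set 0; v]], and [v + v = 0] would
   stop the growth there. *)
have S1N : sumset A 1 != [set: V].
  by apply: contra AN => /eqP/(@sumset_full_leq _ _ 1 2 isT)->.
have S12 := card_sumsetS gA S1N.
have S1E : sumset A 1 = [set 0; v].
  apply/esym/eqP; rewrite eqEcard subUset !sub1set sumset_0 sumset1 !inE Av orbT /=.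
  rewrite cards2 eq_sym; have -> /= : v != 0 by apply: contraNneq Hv => ->; apply: group_zero.
  have S3 : (#|sumset A 3| <= #|H| * 2)%N by rewrite cardH max_card.
  move: S3 H_le2 lt23 S12; rewrite sumset1.
  move: #|H| #|sumset A 3| #|sumset A 2| #|_ |: _| => h a b c; lia.
apply: contraTneq S2 => vv0; rewrite -leqNgt.
have /subset_leq_card : sumset A 2 \subset [set 0; v].
  apply/subsetP=> _ /sumsetSP[y] [a] [+ + ->]; rewrite -sumset1 S1E.
  by move=> /set2P[]-> /set2P[]->; rewrite ?add0r ?addr0 ?vv0 !inE eqxx ?orbT.
by move/leq_trans; apply; rewrite cards2; case: (_ != _).
Qed.

End SmallDiameter.

(** * Comparison of sums from prefix products *)

(** The product is at most the [j]-th power of the mean, so the mean is at least 1; if it is 1, the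
    equality case of AM-GM makes all [t i] equal to it. *)
Lemma sum_ge_of_prod_ge1 (R : realFieldType) (t : nat -> R) (j : nat) :
    (forall i, 0 <= t i) -> 1 <= \prod_(i < j) t i ->
  0 <= \sum_(i < j) (t i - 1) /\
  (\sum_(i < j) (t i - 1) = 0 -> forall i, (i < j)%N -> t i = 1).
Proof.
move=> t0 prod_ge1; rewrite sumrB sumr_const card_ord.
case: j prod_ge1 => [_|j prod_ge1]; first by rewrite big_ord0 mulr0n subrr; split.
have jR : 0 < j.+1%:R :> R by rewrite ltr0n.
have [] := @leif_AGM R 'I_j.+1 predT (fun i => t i) (fun i _ => t0 i).
rewrite card_ord; set mu := (_ / _) => leAG eqAG.
have sE : \sum_(i < j.+1) t i = mu * j.+1%:R by rewrite mulfVK // gt_eqF.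
have mu0 : 0 <= mu by rewrite divr_ge0 ?sumr_ge0 // ltW.
have mu_ge1 : 1 <= mu by rewrite -(expr_ge1 (n := j.+1)) // (le_trans prod_ge1).
rewrite sE -{2 4}[j.+1%:R]mul1r -mulrBl; split; first by rewrite mulr_ge0 ?subr_ge0 // ltW.
move/eqP; rewrite mulf_eq0 subr_eq0 (gt_eqF jR) orbF => /eqP mu1.
move: eqAG leAG sE; rewrite mu1 expr1n eq_le prod_ge1 andbT => + leAG sE.
rewrite leAG => /esym/forall_inP tc i ij.
have ti (k : 'I_j.+1) : t k = t i.
  by have /forall_inP/(_ (Ordinal ij) isT)/eqP := tc k isT.
move: sE; rewrite (eq_bigr (fun=> t i)) // sumr_const card_ord.
by rewrite !mul1r -[RHS]mul1r -[LHS]mulr_natr => /(mulIf (lt0r_neq0 jR)).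
Qed.

(* Summation by parts: with [t i = m i / n i] and [T j] the sum of the [t i - 1], the difference
   of the two sums is at least [n N * T N], and [T N] is nonnegative by AM-GM. *)
Lemma leq_sum_of_prefix_prod (n m : nat -> nat) (N : nat) :
    (forall i, 0 < n i)%N -> (forall i, n i.+1 <= n i)%N ->
    (forall j, j <= N -> \prod_(i < j) n i <= \prod_(i < j) m i)%N ->
  (\sum_(i < N) n i <= \sum_(i < N) m i)%N /\
  ((\sum_(i < N) n i = \sum_(i < N) m i)%N -> forall i, (i < N)%N -> n i = m i).
Proof.
move=> n0 nS nm; pose t i : rat := (m i)%:R / (n i)%:R.
have nR i : 0 < (n i)%:R :> rat by rewrite ltr0n.
have t0 i : 0 <= t i by rewrite divr_ge0 ?ler0n.
have nt i : (m i)%:R = t i * (n i)%:R by rewrite mulfVK // gt_eqF.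
have tprod j : (j <= N)%N -> 1 <= \prod_(i < j) t i.
  move=> /nm; rewrite -(ler_nat rat) !natr_prod.
  rewrite [leRHS](eq_bigr (fun i : 'I_j => t i * (n i)%:R)) // big_split /=.
  by rewrite -[leLHS]mul1r ler_pM2r // prodr_gt0.
have T j (jN : (j <= N)%N) := sum_ge_of_prod_ge1 t0 (tprod j jN).
have abel : (n N)%:R * \sum_(i < N) (t i - 1) <= (\sum_(i < N) m i)%:R - (\sum_(i < N) n i)%:R.
  elim: N {nm tprod} T => [|j IH] T; first by rewrite !big_ord0 mulr0 subrr.
  (* Replacing [n j.+1] by [n j] only enlarges the left side, because the partial sum is
     nonnegative. *)
  rewrite (@le_trans _ _ ((n j)%:R * \sum_(i < j.+1) (t i - 1))) //.
    by rewrite ler_wpM2r ?ler_nat ?nS //; have [] := T j.+1 (leqnn _).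
  rewrite !big_ord_recr /= !natrD opprD addrACA mulrDr lerD //.
    by apply: IH => i ij; apply: T; apply: leqW.
  by rewrite nt mulrBr mulr1 mulrC.
have [TN0 TN1] := T N (leqnn N).
split.
  by rewrite -(ler_nat rat) -subr_ge0 (le_trans _ abel) // mulr_ge0 // ltW.
move=> sE i iN; move: abel; rewrite sE subrr pmulr_rle0 // => TN.
have t1 := TN1 (le_anti (introT andP (conj TN TN0))) i iN.
by apply/eqP; rewrite -(eqr_nat rat) nt t1 mul1r.
Qed.

(** * Orders of subgroups of bounded rank *)

(** Padding with 1 lets sequences of different lengths share one index range; [g 1 = idx] makes the
    padding neutral. *)
Lemma big_nth_widen (R : Type) (idx : R) (op : Monoid.com_law idx) (s : seq nat)
    (g : nat -> R) (N : nat) : g 1%N = idx -> (size s <= N)%N ->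
  \big[op/idx]_(y <- s) g y = \big[op/idx]_(i < N) g (nth 1%N s i).
Proof.
move=> g1 sN; rewrite (big_nth 1%N) big_mkord (big_ord_widen N (fun i => g (nth 1%N s i))) //.
rewrite big_mkcond /=; apply: eq_bigr => i _; case: ltnP => // si.
by rewrite nth_default.
Qed.

Section InvariantFactors.
Variable gT : finGroupType.
Local Open Scope group_scope.
Implicit Types (G H : {group gT}) (b : seq gT).

Lemma mem_bigdprod_cycle b G x :
  \big[dprod/1]_(y <- b) <[y]> = G -> x \in b -> x \in G.
Proof.
elim: b G => // y b IH G; rewrite big_cons => /dprodP[[_ K _ defK] <- _ _].
rewrite defK inE => /predU1P[->|xb]; first exact: (subsetP (mulG_subl K _) _ (cycle_id y)).
exact: (subsetP (mulG_subr <[y]>%G K) _ (IH K defK xb)).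
Qed.

(** A cyclic decomposition has at most [j] factors, each of order at most [m]. *)
Lemma card_abelian_exponent G j m : abelian G -> ('r(G) <= j)%N -> (0 < m)%N ->
  (forall x, x \in G -> x ^+ m = 1) -> (#|G| <= m ^ j)%N.
Proof.
move=> cGG rGj m0 xm; have [b defG tb] := abelian_structure cGG.
have sub := mem_bigdprod_cycle defG.
rewrite -(bigdprod_card defG) (@leq_trans (m ^ size b)) //; last first.
  by rewrite leq_pexp2l // -(size_map order) tb size_abelian_type.
elim: b sub {defG tb} => [|x b IH] sub; first by rewrite big_nil.
rewrite big_cons expnS leq_mul //; last by apply: IH => y yb; rewrite sub // inE yb orbT.
by rewrite dvdn_leq // order_dvdn xm // sub // mem_head.
Qed.

(** The image is the product of the images of the cyclic factors; these may intersect, hence only an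
    inequality. *)
Lemma card_morphim_bigdprod (rT : finGroupType) (D : {group gT}) (f : {morphism D >-> rT}) b G :
  \big[dprod/1]_(x <- b) <[x]> = G -> G \subset D ->
  (#|f @* G| <= \prod_(x <- b) #[f x])%N.
Proof.
elim: b G => [|x b IH] G; first by rewrite !big_nil => <-; rewrite morphim1 cards1.
rewrite !big_cons => /dprodP[[_ K _ defK] <- _ _] sGD.
have [xD KD] : x \in D /\ K \subset D.
  split; first by apply: (subsetP sGD); rewrite defK (subsetP (mulG_subl K _)) ?cycle_id.
  by apply: subset_trans sGD; rewrite defK mulG_subr.
rewrite defK morphimMl ?cycle_subG // morphim_cycle //.
rewrite (@leq_trans (#[f x] * #|f @* K|)) //; last by rewrite leq_mul2l IH ?orbT.
by rewrite /order mul_cardG leq_pmulr // cardG_gt0.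
Qed.

(* With [m] the next invariant factor of [G], [x |-> x ^+ m] kills at most [m ^ j] elements of [H],
   and its image lies in that of [G], which has the order of the product of the [a_i / m]. *)
Lemma card_sub_abelian G H j : abelian G -> H \subset G -> ('r(H) <= j)%N ->
  (#|H| <= \prod_(i < j) nth 1%N (abelian_type G) i)%N.
Proof.
move=> cGG sHG rHj; have [b defG tb] := abelian_structure cGG.
set s := abelian_type G; set m := nth 1%N s j.
have s_gt0 i : (0 < nth 1%N s i)%N.
  have [iS|/(nth_default 1%N)->//] := ltnP i (size s).
  by have /allP/(_ _ (mem_nth 1%N iS))/ltnW := abelian_type_gt1 G.
have s_dvd i k : (i <= k)%N -> (nth 1%N s k %| nth 1%N s i)%N.
  move=> ik; have [kS|/(nth_default 1%N)->] := ltnP k (size s); last exact: dvd1n.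
  have tr : transitive [rel m0 n0 : nat | (n0 %| m0)%N] by move=> y x z /= xy /dvdn_trans; apply.
  have := sorted_leq_nth tr (fun x => dvdnn x) 1%N (abelian_type_dvdn_sorted G).
  by apply=> //; rewrite inE // (leq_ltn_trans ik).
have fM : {in G &, {morph (fun x => x ^+ m) : x y / x * y}}.
  by move=> x y Gx Gy /=; rewrite expgMn //; apply: (centsP cGG).
pose f := Morphism fM.
have cardH : #|H| = (#|'ker_H f| * #|f @* H|)%N.
  by rewrite card_morphim (setIidPr sHG) LagrangeI.
have kerH : (#|'ker_H f| <= m ^ j)%N.
  apply: card_abelian_exponent; last by move=> x /setIP[Hx /mker].
  - exact: abelianS (subset_trans (subsetIl _ _) sHG) cGG.
  - by apply: leq_trans (rankS _) rHj; rewrite subsetIl.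
  exact: s_gt0.
have imH : (#|f @* H| <= \prod_(i < j) (nth 1%N s i %/ m))%N.
  apply: leq_trans (subset_leq_card (morphimS f sHG)) _.
  apply: leq_trans (card_morphim_bigdprod f defG (subxx G)) _.
  rewrite (eq_bigr (fun x => #[x] %/ gcdn #[x] m)%N); last by move=> x _; rewrite orderXgcd.
  have -> : (\prod_(x <- b) (#[x] %/ gcdn #[x] m) = \prod_(y <- s) (y %/ gcdn y m))%N.
    by rewrite /s -tb big_map.
  rewrite (@big_nth_widen _ _ _ s (fun y => y %/ gcdn y m)%N (j + size s)) ?leq_addl //; last first.
    by rewrite gcd1n.
  (* Factors from index [j] on divide [m], so they contribute 1. *)
  rewrite big_split_ord /= [X in (_ * X)%N]big1 ?muln1; last first.
    move=> i _; have /gcdn_idPl-> := s_dvd j (j + i)%N (leq_addr _ _).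
    by rewrite divnn s_gt0.
  by apply: leq_prod => i _; have /gcdn_idPr-> := s_dvd i j (ltnW (ltn_ord i)).
rewrite cardH (leq_trans (leq_mul kerH imH)) //.
rewrite -{1}[j]card_ord -prod_nat_const -big_split /=; apply: leq_prod => i _.
by rewrite mulnC divnK // s_dvd // ltnW.
Qed.

End InvariantFactors.

(** * Maximal diameter *)

Section GreedyChain.
Variables (V : finZmodType) (A : {set V}).
Implicit Types (H K : {group V}) (x y : V).

Lemma group_norm H (B : {set V}) : B \subset 'N(H)%g.
Proof.
apply: subset_trans (subsetT B) _.
by apply: sub_abelian_norm (subsetT H); apply: zmod_abelian.
Qed.

(** The index counts the cosets of [H] met by multiples of [x], so it is the order of [x] modulo
    [H], whether or not [H] lies in [<[x]>]. *)
Lemma mulrn_index H x : x *+ #|<[x]>%g : H|%g \in H.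
Proof.
have nHx : x \in 'N(H)%g by apply: (subsetP (group_norm H [set: V])); rewrite inE.
rewrite -zmodXgE; apply: coset_idr; first exact: groupX.
rewrite morphX // -card_quotient ?cycle_subG //.
by apply: expg_cardG; rewrite mem_morphim ?cycle_id.
Qed.

(** Admitting 0 keeps the range nonempty; modulo the whole group every choice has index 1, so the
    chain continues indefinitely. *)
Definition greedy H : V := [arg max_(a > 0%R in 0%R |: A) #|<[a]>%g : H|%g]%N.

Definition chain j : {group V} := iter j (fun H => (H <*> <[greedy H]>)%G) 1%G.

Definition chain_gen j : V := greedy (chain j).

Definition chain_index j : nat := #|<[chain_gen j]>%g : chain j|%g.

Lemma chainS j : chain j.+1 = (chain j <*> <[chain_gen j]>)%G.
Proof. by []. Qed.

Lemma chain_gen_in j : chain_gen j \in 0 |: A.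
Proof. by rewrite /chain_gen /greedy; case: arg_maxnP => //; rewrite setU11. Qed.

Lemma chain_index_max j a : a \in 0 |: A -> (#|<[a]>%g : chain j|%g <= chain_index j)%N.
Proof.
move=> Aa; rewrite /chain_index /chain_gen /greedy.
by case: arg_maxnP; rewrite ?setU11 // => b _; apply.
Qed.

Lemma chain_index_gt0 j : (0 < chain_index j)%N.
Proof. exact: indexg_gt0. Qed.

(** Enlarging the subgroup cannot raise the order of [chain_gen j.+1], and modulo [chain j] that
    order is at most the maximum chosen there. *)
Lemma chain_indexS j : (chain_index j.+1 <= chain_index j)%N.
Proof.
apply: leq_trans (chain_index_max j (chain_gen_in j.+1)).
by apply: dvdn_leq (indexg_gt0 _ _) _; rewrite indexgS // joing_subl.
Qed.

Lemma chainSE j : chain j.+1 = (chain j * <[chain_gen j]>)%g :> {set V}.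
Proof.
by rewrite chainS /= norm_joinEr // group_norm.
Qed.

Lemma card_chain j : #|chain j| = (\prod_(i < j) chain_index i)%N.
Proof.
elim: j => [|j IH]; first by rewrite big_ord0 cards1.
rewrite big_ord_recr -IH chainSE /=; apply/eqP.
rewrite -(eqn_pmul2r (cardG_gt0 (chain j :&: <[chain_gen j]>)%G)) -mul_cardG.
by rewrite -mulnA [(chain_index j * _)%N]mulnC /chain_index /= setIC LagrangeI.
Qed.

Lemma chain_rank j : ('r(chain j)%g <= j)%N.
Proof.
rewrite -grank_abelian ?zmod_abelian //.
have [B -> cardB] : exists2 B : {set V}, chain j = <<B>>%g :> {set V} & (#|B| <= j)%N.
  elim: j => [|j [B HB cardB]]; first by exists set0; rewrite ?gen0 ?cards0.
  exists (chain_gen j |: B); last by rewrite cardsU1; apply: leq_add (leq_b1 _) cardB.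
  by rewrite chainS /= HB joing_idl joing_idr joingE setUC.
exact: leq_trans (grank_min B) cardB.
Qed.

Lemma chain_prefix_prod j :
  (\prod_(i < j) chain_index i <= \prod_(i < j) nth 1%N (abelian_type [set: V]) i)%N.
Proof.
rewrite -card_chain; apply: (card_sub_abelian (G := [set: V]%G)); rewrite ?subsetT ?zmod_abelian //.
exact: chain_rank.
Qed.

(** Mixed-radix expansion: divide the last coefficient by the index [n]; the part divisible by [n]
    lies in the preceding subgroup and is absorbed there. *)
Lemma chain_coord j x : x \in chain j -> exists2 c : nat -> nat,
  (forall i, c i < chain_index i)%N & x = \sum_(i < j) chain_gen i *+ c i.
Proof.
elim: j x => [|j IH] x.
  move/set1P->; exists (fun=> 0%N); first exact: chain_index_gt0.
  by rewrite big_ord0.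
rewrite chainSE => /mulsgP[h _ Hh /cycleP[k ->] ->].
set n := chain_index j; set a := chain_gen j.
have [|c cn hE] := IH (h + a *+ n *+ (k %/ n)).
  by apply: group_add => //; apply: group_mulrn; apply: mulrn_index.
exists (fun i => if i == j then k %% n else c i)%N.
  by move=> i; case: eqP => // ->; rewrite ltn_pmod ?chain_index_gt0.
rewrite big_ord_recr /= eqxx (eq_bigr (fun i : 'I_j => chain_gen i *+ c i)); last first.
  by move=> i _; rewrite ltn_eqF.
by rewrite -hE zmodMgE zmodXgE {1}(divn_eq k n) mulrnDr mulnC mulrnA addrA.
Qed.

Hypothesis gA : generates A.

(** While the chain is proper, some element of [A] lies outside it, so the next step at least
    doubles the order. *)
Lemma chain_full N : (#|V| <= N)%N -> chain N = [set: V] :> {set V}.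
Proof.
move=> VN; suff [//|] : chain N = [set: V] :> {set V} \/ (N < #|chain N|)%N.
  by rewrite ltnNge (leq_trans (max_card _) VN).
elim: N {VN} => [|j [HT|Hj]]; first by right; rewrite cards1.
  by left; apply/eqP; rewrite eqEsubset subsetT -HT joing_subl.
have [HT|/eqP HN] := eqVneq (chain j : {set V}) [set: V].
  by left; apply/eqP; rewrite eqEsubset subsetT -HT joing_subl.
right; rewrite card_chain big_ord_recr /= -card_chain.
suff n2 : (1 < chain_index j)%N by rewrite (leq_trans _ (leq_mul Hj n2)) //; lia.
have [b Ab Hb] : exists2 b, b \in A & b \notin chain j.
  by apply/subsetPn; apply/negP => /(generates_sub_group gA).
apply: leq_trans (chain_index_max j (_ : b \in 0 |: A)); last by rewrite inE Ab orbT.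
by rewrite indexg_gt1 cycle_subG.
Qed.

End GreedyChain.

Section MaximalDiameter.
Variable V : finZmodType.
Implicit Types (A B : {set V}).

Let s := abelian_type [set: V].

Lemma size_type_grank : size s = 'm([set: V])%g.
Proof. by rewrite (grank_abelian (zmod_abelian [set: V])) size_abelian_type // zmod_abelian. Qed.

Lemma generates_card_geq A : generates A -> (size s <= #|A|)%N.
Proof. by rewrite generatesE size_type_grank => /eqP <-; apply: grank_min. Qed.

Lemma rkE : rk V = size s.
Proof.
apply/eqP; rewrite eqn_leq; apply/andP; split; last first.
  rewrite /rk; elim/big_ind: _ => [|m n|A]; last exact: generates_card_geq.
    by apply: generates_card_geq; apply: generates_setT.
  by rewrite leq_min => -> ->.
have [B gB cB] := grank_witness [set: V]%G.
rewrite size_type_grank -cB /rk; move/eqP: gB; rewrite -generatesE => gB.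
elim: (index_enum _) (mem_index_enum B) => // C r IH; rewrite inE big_cons.
case/predU1P=> [<-|/IH le_r]; first by rewrite gB geq_minl.
by case: ifP => // _; rewrite geq_min le_r orbT.
Qed.

(* Greedy choice makes the indices [n_i] nonincreasing, with partial products bounded by those of the
   invariant factors [m_i]. If some [n_i <> m_i] the sum drops; otherwise the chain uses at most
   [size s] generators, and a leftover [c] in [A] shortens the longest representation. *)
Lemma sumset_full_of_large A (D := (\sum_(y <- s) y.-1)%N) :
  generates A -> (size s < #|A :\ 0%R|)%N ->
  exists2 e, (e < D)%N & sumset A e = [set: V].
Proof.
(* Long enough for the chain to exhaust the group and for all invariant factors to be indexed. *)
move=> gA cardA; pose N := (#|V| + size s)%N.
pose n := chain_index A; pose a := chain_gen A; pose m := nth 1%N s.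
have n_gt0 i : (0 < n i)%N := chain_index_gt0 A i.
have sub1 (f : nat -> nat) : (forall i, 0 < f i)%N ->
    (\sum_(i < N) f i = \sum_(i < N) (f i).-1 + N)%N.
  move=> f0; have NE : (\sum_(i < N) 1 = N)%N by rewrite sum1_card card_ord.
  rewrite -[X in (_ + X)%N]NE -big_split /=.
  by apply: eq_bigr => i _; rewrite addn1 prednK.
have m_gt0 i : (0 < m i)%N.
  have [iS|/(nth_default 1%N)] := ltnP i (size s); last by rewrite /m => ->.
  by have /allP/(_ _ (mem_nth 1%N iS))/ltnW := abelian_type_gt1 [set: V].
have m_gt1 i : (1 < m i)%N -> (i < size s)%N.
  by apply: contraLR; rewrite -leqNgt => /(nth_default 1%N); rewrite /m => ->.
have DE : D = (\sum_(i < N) (m i).-1)%N.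
  by rewrite /D (@big_nth_widen _ _ _ s predn N) // leq_addl.
have coord x : exists2 c : nat -> nat, (forall i, c i < n i)%N & x = \sum_(i < N) a i *+ c i.
  by apply: chain_coord; rewrite chain_full ?inE // leq_addr.
have in_sumset c : \sum_(i < N) a i *+ c i \in sumset A (\sum_(i < N) c i).
  exact: (@sumset_sum _ _ _ _ (fun i : 'I_N => a i)  (fun i : 'I_N => c i) (fun i => chain_gen_in A i)).
have c_le c : (forall i, c i < n i)%N -> (\sum_(i < N) c i <= \sum_(i < N) (n i).-1)%N.
  by move=> cn; apply: leq_sum => i _; rewrite -ltnS prednK.
have [le_nm eq_nm] := leq_sum_of_prefix_prod (N := N) n_gt0 (chain_indexS A)
  (fun j _ => chain_prefix_prod A j).
rewrite -/n -/m in le_nm eq_nm.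
have [ltD|leD] := ltnP (\sum_(i < N) (n i).-1)%N D.
  exists (\sum_(i < N) (n i).-1)%N => //; apply/setP=> x; rewrite inE.
  have [c cn ->] := coord x; exact: (subsetP (sumset_leq A (c_le c cn))).
have sumE : (\sum_(i < N) (n i).-1 = D)%N.
  apply/eqP; rewrite eqn_leq leD andbT DE -(leq_add2r N) -!sub1 //.
have nm : forall i, (i < N)%N -> n i = m i.
  by apply: eq_nm; rewrite !sub1 // sumE DE.
have [c Ac cN] : exists2 c, c \in A :\ 0 & c \notin [seq a i | i <- iota 0 (size s)].
  apply/subsetPn; apply: contraL cardA => /subset_leq_card le; rewrite -leqNgt.
  by apply: leq_trans le (leq_trans (card_size _) _); rewrite size_map size_iota.
move: Ac; rewrite !inE => /andP[c0 Ac].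
have [d dn cE] := coord c.
(* [c] is no single chain generator: a lone coordinate 1 at [i] needs [n i > 1], hence [i < size s],
   which was excluded. *)
have d2 : (1 < \sum_(i < N) d i)%N.
  rewrite ltnNge; apply/negP; rewrite leq_eqVlt ltnS leqn0.
  case/orP => [|/eqP d0]; last first.
    case/negP: c0; rewrite cE big1 // => i _.
    by move/eqP: d0; rewrite sum_nat_eq0 => /forall_inP/(_ i isT)/eqP->.
  case/sum_nat_eq1 => i [_ di dj].
  case/negP: cN; apply/mapP; exists (i : nat).
    by rewrite mem_iota add0n m_gt1 // -nm // -di dn.
  rewrite cE (bigD1 i) //= di mulr1n big1 ?addr0 // => j ji.
  by rewrite dj.
have D_gt0 : (0 < D)%N by rewrite -sumE; have := c_le d dn; lia.
exists D.-1; first by rewrite prednK.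
apply/setP=> x; rewrite inE; have [cx cxn xE] := coord x.
have := c_le cx cxn; rewrite sumE leq_eqVlt => /orP[/eqP eqD|ltD]; last first.
  rewrite xE; apply: (subsetP (sumset_leq A (_ : _ <= D.-1)%N)) (in_sumset cx).
  by rewrite -ltnS prednK.
(* Only the element with all coordinates maximal has length [D]; replacing the part equal to [c], of
   length at least 2, by [c] itself saves a summand. *)
pose k i := ((n i).-1 - d i)%N.
have cx_le (i : 'I_N) : (cx i <= (n i).-1)%N by rewrite -ltnS prednK.
have cx_max i : (i < N)%N -> cx i = (n i).-1.
  move=> iN; have [_] := leqif_sum (P := predT) (fun (j : 'I_N) _ => leqif_eq (cx_le j)).
  by rewrite sumE eqD eqxx => /esym/forall_inP/(_ (Ordinal iN) isT)/eqP.
have -> : x = c + \sum_(i < N) a i *+ k i.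
  rewrite {1}cE xE -big_split /=; apply: eq_bigr => i _; rewrite -mulrnDr cx_max //.
  by rewrite subnKC // -ltnS prednK.
have kE : (\sum_(i < N) k i + \sum_(i < N) d i = D)%N.
  rewrite -sumE -big_split; apply: eq_bigr => i _ /=; rewrite /k subnK //.
  by rewrite -ltnS prednK.
apply: (subsetP (sumset_leq A (_ : 1 + \sum_(i < N) k i <= _)%N)); first by lia.
by apply: sumsetD => //; rewrite sumset1 !inE Ac orbT.
Qed.

(** * Bases and the lower bound for the diameter *)

Lemma bigdprod_uniq (gT : finGroupType) (b : seq gT) (G : {group gT}) :
  (\big[dprod/1]_(x <- b) <[x]> = G)%g -> 1%g \notin b -> uniq b.
Proof.
elim: b G => // x b IH G; rewrite big_cons inE negb_or.
move=> /dprodP[[_ K _ defK] _ _ tI] /andP[x1 b1] /=; rewrite (IH K) // andbT.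
apply: contra x1 => xb; rewrite eq_sym -in_set1 -[[set 1%g]]/(1%g : {set gT}) -tI.
by rewrite inE cycle_id defK (mem_bigdprod_cycle defK).
Qed.

Lemma bigdprod_sub (gT : finGroupType) (b : seq gT) (G H : {group gT}) :
  (\big[dprod/1]_(x <- b) <[x]> = G)%g -> {subset b <= H} -> G \subset H.
Proof.
elim: b G => [|x b IH] G; first by rewrite big_nil => <- _; rewrite sub1G.
rewrite big_cons => /dprodP[[_ K _ defK] <- _ _] bH.
rewrite defK mul_subG ?cycle_subG ?bH ?mem_head // (IH K) // => y yb.
by rewrite bH // inE yb orbT.
Qed.

Lemma bigdprod_sum_in (b : seq V) (G : {group V}) (c : V -> nat) :
  (\big[dprod/1]_(x <- b) <[x]> = G)%g -> \sum_(x <- b) x *+ c x \in G.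
Proof.
move=> defG; rewrite big_seq; elim/big_ind: _ => [|x y|x xb]; first exact: group_zero.
  exact: group_add.
by apply: group_mulrn; apply: mem_bigdprod_cycle defG xb.
Qed.

(** Coordinates in a direct sum are unique modulo the orders, and a natural number congruent to
    [#[x] - 1] modulo [#[x]] is at least [#[x] - 1]. *)
Lemma bigdprod_top_coord (b : seq V) (G : {group V}) (c : V -> nat) :
    (\big[dprod/1]_(x <- b) <[x]> = G)%g ->
    \sum_(x <- b) x *+ c x = \sum_(x <- b) x *+ #[x]%g.-1 ->
  (\sum_(x <- b) #[x]%g.-1 <= \sum_(x <- b) c x)%N.
Proof.
elim: b G => [|x b IH] G; first by rewrite !big_nil.
rewrite !big_cons => /dprodP[[_ K _ defK] _ _ tI] eq_sum.
have cK := bigdprod_sum_in _ defK.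
have eqx : x *+ c x = x *+ #[x]%g.-1.
  apply/eqP; rewrite -subr_eq0 -in_set1 -[[set 0]]/(1%g : {set V}) -tI inE; apply/andP; split.
    by apply: group_add; rewrite ?group_opp; apply: group_mulrn; apply: cycle_id.
  have -> : x *+ c x - x *+ #[x]%g.-1 = \sum_(y <- b) y *+ #[y]%g.-1 - \sum_(y <- b) y *+ c y.
    by apply/eqP; rewrite subr_eq addrAC eq_sym subr_eq eq_sum addrC.
  by rewrite defK group_add ?group_opp ?cK.
apply: leq_add; last by apply: IH defK _; move: eq_sum; rewrite eqx => /addrI.
move/eqP: eqx; rewrite -!zmodXgE eq_expg_mod_order => /eqP/esym cx.
by rewrite -(modn_small (_ : #[x]%g.-1 < #[x]%g)%N) ?prednK // cx leq_mod.
Qed.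

Lemma sumset_coord (b : seq V) t x : uniq b -> x \in sumset [set y in b] t ->
  exists2 c : V -> nat, x = \sum_(y <- b) y *+ c y & (\sum_(y <- b) c y <= t)%N.
Proof.
move=> ub; elim: t x => [|t IH] x.
  rewrite sumset0 => /set1P->; exists (fun=> 0%N); first by rewrite big1.
  by rewrite big1.
case/sumsetSP=> y [a] [/IH[c -> ct] + ->]; rewrite !inE => /predU1P[->|ab].
  by exists c; rewrite ?addr0 // ltnW.
have aE : \sum_(z <- b) z *+ (z == a) = a.
  by rewrite (bigD1_seq a) //= eqxx big1 ?addr0 // => z /negPf->.
have aN : (\sum_(z <- b) (z == a) = 1)%N.
  by rewrite (bigD1_seq a) //= eqxx big1 // => z /negPf->.
exists (fun z => c z + (z == a))%N.
  rewrite [RHS](eq_bigr (fun z => z *+ c z + z *+ (z == a))); last by move=> z _; rewrite mulrnDr.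
  by rewrite big_split /= aE.
by rewrite big_split /= aN addn1.
Qed.

(** The sum of the basis elements with top coefficients needs [D] summands. *)
Lemma basis_diam (D := (\sum_(y <- s) y.-1)%N) :
  exists2 B : {set V}, generates B & forall e, (e < D)%N -> sumset B e != [set: V].
Proof.
have [b defG tb] := abelian_structure (zmod_abelian [set: V]).
have b1 : 1%g \notin b.
  have := abelian_type_gt1 [set: V]; rewrite -tb all_map.
  by apply: contraL => b1; apply/allPn; exists 1%g; rewrite //= order1.
have ub := bigdprod_uniq (G := [set: V]%G) defG b1.
exists [set y in b].
  apply: generatesP => H sBH; apply/eqP; rewrite eqEsubset subsetT.
  by apply: (bigdprod_sub (G := [set: V]%G) defG) => x xb; apply: (subsetP sBH); rewrite inE.
move=> e; apply: contraL => /eqP Be; rewrite -leqNgt.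
have : \sum_(x <- b) x *+ #[x]%g.-1 \in sumset [set y in b] e by rewrite Be inE.
case/(sumset_coord ub) => c /esym/(bigdprod_top_coord (G := [set: V]%G) defG) le ce.
by rewrite /D /s -tb big_map (leq_trans le).
Qed.

Lemma trho_srho rho : diamP V = Some rho -> (2 <= rho)%N ->
  t_ V rho = (rk V).+1 /\ s_ V rho = (rk V).+1.
Proof.
move=> dV rho2; rewrite rkE.
have rho_gt0 : (0 < rho)%N by apply: ltnW.
have ge_rho : (\sum_(y <- s) y.-1 <= rho)%N.
  have [B gB NB] := basis_diam; rewrite leqNgt; apply/negP => /NB.
  by rewrite (diamP_max dV gB) eqxx.
have small A : generates A -> sumset A rho.-1 != [set: V] -> (#|A :\ 0%R| <= size s)%N.
  move=> gA; rewrite leqNgt; apply: contra => /(sumset_full_of_large gA)[e eD Ae].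
  by apply/eqP; apply: sumset_full_leq Ae; have := leq_trans eD ge_rho; lia.
have [|A0 gA0 A0N] := @oge_diamP V rho rho_gt0; first by rewrite dV /= leqnn.
(* Adjoining 0 changes no sumset and accounts for the extra 1 in the cardinality. *)
pose A := 0 |: A0.
have sumA t : sumset A t = sumset A0 t.
  by elim: t => // t IH; apply/setP=> x; apply/sumsetSP/sumsetSP=> -[y] [a];
    rewrite IH /A setUA setUid => H; exists y, a.
have gA : generates A by apply: generatesS gA0; rewrite subsetUr.
have AN : sumset A rho.-1 != [set: V] by rewrite sumA.
have A0in : 0 \in A by rewrite setU11.
have large B : B \subset A -> A :\ 0 \subset <<B>>%g -> (size s <= #|B|)%N.
  move=> sBA sAB; apply: generates_card_geq; apply: generatesP => H sBH.
  apply: (generates_sub_group gA); apply/subsetP=> x Ax.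
  have [->|x0] := eqVneq x 0; first exact: group_zero.
  have := subsetP sAB x; rewrite in_setD1 x0 Ax => /(_ isT); apply: subsetP.
  by rewrite gen_subG.
have cardA' : #|A :\ 0%R| = size s.
  by apply/eqP; rewrite eqn_leq small // large // ?subsetDl // subset_gen.
have cardA : #|A| = (size s).+1 by rewrite (cardsD1 0 A) A0in cardA'.
apply: (@extremal_card V rho _ A) => //.
  move=> B gB BN; rewrite (cardsD1 0 B) -add1n; apply: leq_add (leq_b1 _) _.
  exact: small.
apply: aperiodicP => k /periodP kA; apply/eqP; apply: contraT => k0.
have Ak : k \in A by rewrite -[k]add0r kA.
(* If neither [a] nor [a + k] is 0, then [a + k] is redundant, since [a] and [k] remain; this leaves
   fewer than [size s] generators. *)
have only a : a \in A -> a = 0 \/ a + k = 0.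
  move=> Aa; have [->|a0] := eqVneq a 0; first by left.
  have [->|ak0] := eqVneq (a + k) 0; first by right.
  have akk : a + k != k by rewrite -subr_eq0 addrK.
  have aak : a != a + k by rewrite -subr_eq0 opprD addrA subrr sub0r oppr_eq0.
  have Aak : a + k \in A :\ 0 by rewrite in_setD1 ak0 kA.
  have := large (A :\ 0 :\ (a + k)).
  rewrite (subset_trans (subsetDl _ _) (subsetDl _ _)) -cardA' (cardsD1 (a + k) (A :\ 0)) Aak ltnn.
  move/(_ isT)=> contra; suff: false by [].
  apply: contra; apply/subsetP=> x Ax.
  have [->|xak] := eqVneq x (a + k); last by apply: mem_gen; rewrite in_setD1 xak.
  apply: group_add; apply: mem_gen; rewrite !in_setD1.
    by rewrite aak a0.
  by rewrite eq_sym akk k0.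
have kk : k + k = 0 by have [/eqP|//] := only k Ak; rewrite (negPf k0).
(* Now [A] is [{0, k}] with [k + k = 0], a subgroup. As it generates, it is the whole group, reached
   with one summand, while [rho.-1] is at least 1. *)
have gS : group_set A.
  apply/group_setP; split=> // x y Ax Ay; rewrite zmodMgE.
  have [->|yk] := only y Ay; first by rewrite addr0.
  by rewrite (_ : y = k) ?kA //; apply/eqP; rewrite -subr_eq0 -(addrK k y) yk sub0r -opprD kk oppr0.
case/negP: AN; apply/eqP; apply: (@sumset_full_leq _ _ 1); first by lia.
have AT := generates_sub_group (H := group gS) gA (subxx _).
by rewrite sumset1 /A setUA setUid; apply: AT.
Qed.

End MaximalDiameter.

Local Close Scope ring_scope.

Theorem theorem2p4 (V : finZmodType) :
  [/\ (oge (diamP V) 1 -> t_ V 1 = 0%N /\ s_ V 1 = #|[set: V]|),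
      (oge (diamP V) 2 -> t_ V 2 = #|[set: V]|.-1 /\ s_ V 2 = #|[set: V]|.-1),
      (oge (diamP V) 3 -> t_ V 3 = (#|[set: V]| %/ 2)%N /\ s_ V 3 = (#|[set: V]| %/ 2)%N) &
      (forall rho : nat, diamP V = Some rho -> (2 <= rho)%N ->
         t_ V rho = (rk V).+1 /\ s_ V rho = (rk V).+1)].
Proof.
split=> [d1|d2|d3|rho].
(* Diameter at least [r] means [r] strict increases of the sumsets, so the order of the group
   exceeds [r]. *)
- have [A gA AN] := oge_diamP (isT : 0 < 1) d1; apply: t1_s1.
  exact: leq_trans (leq_ltn_trans (card_sumset_gt gA AN) (card_sumsetS gA AN)) (max_card _).
- have [A gA AN] := oge_diamP (isT : 0 < 2) d2; apply: t2_s2.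
  exact: leq_trans (leq_ltn_trans (card_sumset_gt gA AN) (card_sumsetS gA AN)) (max_card _).
- by have [A gA AN] := oge_diamP (isT : 0 < 3) d3; apply: t3_s3 gA AN.
exact: trho_srho.
Qed.
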